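(* Let $G$ be a finite simple graph with $|V(G)|=n$. Then: (i) if $G$ is connected, then $\widetilde{d}(G,n)=1$ and $\widetilde{d}(G,n-1)=n$; (ii) for every integer $i \ge 0$, $\widetilde{d}(G,i)=0$ if and only if $i<\widetilde{\gamma}_c(G)$ or $i>n$; (iii) $\widetilde{D}(G,x)$ has no constant term (its constant coefficient is $0$); (iv) $\widetilde{D}(G,x)$, viewed as a real function of $x$, is strictly increasing on $[1,\infty)$; (v) for every induced subgraph $H$ of $G$, $\deg \widetilde{D}(G,x)\ge \deg \widetilde{D}(H,x)$; (vi) zero is a root of $\widetilde{D}(G,x)$ with multiplicity $\widetilde{\gamma}_c(G)$; (vii) for every spanning subgraph $H$ of $G$, $\widetilde{\gamma}_c(G)\le\widetilde{\gamma}_c(H)$.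
   Context: All graphs are finite, simple, and have nonempty vertex set. A set $S\subseteq V(G)$ is a dominating set of $G$ if every vertex of $V(G)\setminus S$ is adjacent to at least one vertex of $S$. A set $S\subseteq V(G)$ is an outer-connected dominating set (ocd-set) of $G$ if $S$ is a dominating set of $G$ and either $S=V(G)$ or the subgraph of $G$ induced by $V(G)\setminus S$ is connected. The outer-connected domination number $\widetilde{\gamma}_c(G)$ is the minimum cardinality of an ocd-set of $G$. Let $\widetilde{d}(G,i)$ be the number of ocd-sets of $G$ of cardinality $i$. The outer-connected domination polynomial of $G$ is $\widetilde{D}(G,x)=\sum_{i=\widetilde{\gamma}_c(G)}^{|V(G)|}\widetilde{d}(G,i)\,x^i$. A spanning subgraph of $G$ is a subgraph with the same vertex set as $G$.
   Formalization: In (i), the equation d(G,n-1)=n is claimed only for n>1, since it fails for the one-vertex graph K_1: the empty set is not dominating, so d(K_1,0)=0 rather than 1. *)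

(* Defs.v *)
From HB Require Import structures.
From mathcomp Require Import all_boot all_order all_algebra.
From mathcomp Require Import reals.

Set Implicit Arguments.
Unset Strict Implicit.
Unset Printing Implicit Defensive.

Import Order.TTheory GRing.Theory Num.Theory.

(* The vertex type may be empty: nonemptiness is a separate hypothesis where
   graphs are quantified over. *)
Record sgraph (T : finType) := SGraph {
  adj : rel T;
  adj_sym : symmetric adj;
  adj_irr : irreflexive adj
}.

Section Graphs.
Variable T : finType.
Implicit Types (G H : sgraph T) (A S : {set T}).

Definition induced_adj G A : rel {x : T | x \in A} :=
  fun x y => adj G (val x) (val y).

Lemma induced_adj_sym G A : symmetric (@induced_adj G A).
Proof. by move=> x y; apply: adj_sym. Qed.

Lemma induced_adj_irr G A : irreflexive (@induced_adj G A).
Proof. by move=> x; apply: adj_irr. Qed.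

Definition induced G A : sgraph {x : T | x \in A} :=
  SGraph (@induced_adj_sym G A) (@induced_adj_irr G A).

Definition spanning_subgraph H G : Prop := subrel (adj H) (adj G).

End Graphs.

Definition connected_graph (T : finType) (G : sgraph T) : bool :=
  [forall x, forall y, connect (adj G) x y].

Section OuterConnectedDomination.
Variables (T : finType) (G : sgraph T).
Implicit Type S : {set T}.

Definition dominating S : bool :=
  [forall v, (v \notin S) ==> [exists u in S, adj G v u]].

Definition ocd_set S : bool :=
  dominating S && ((S == [set: T]) || connected_graph (induced G (~: S))).

Lemma ocd_setT : ocd_set [set: T].
Proof.
by rewrite /ocd_set eqxx andbT; apply/forallP => v; rewrite in_setT.
Qed.

(* The arg min ranges over a nonempty family, by ocd_setT. *)
Definition ocd_number : nat := #|[arg min_(S < [set: T] | ocd_set S) #|S|]|.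

Definition ocd_count (i : nat) : nat :=
  #|[set S : {set T} | ocd_set S & #|S| == i]|.

Definition ocd_poly (R : nzRingType) : {poly R} :=
  (\sum_(ocd_number <= i < #|T|.+1) (ocd_count i)%:R *: 'X^i)%R.

End OuterConnectedDomination.

(* Main.v *)
(** Everything rests on one fact: an ocd-set [S] can be enlarged to an ocd-set
    of any size between [#|S|] and the order of the graph.  Supersets of [S]
    dominate, and the connected complement of [S] contains connected subsets of
    every smaller size, grown one vertex at a time across an edge leaving the
    current subset.  Hence the coefficients of the polynomial are nonzero
    exactly between the outer-connected domination number and the order. *)

Require Import Defs.
From HB Require Import structures.
From mathcomp Require Import all_boot all_order all_algebra.
From mathcomp Require Import reals.

Set Implicit Arguments.
Unset Strict Implicit.
Unset Printing Implicit Defensive.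

Import Order.TTheory GRing.Theory Num.Theory.
Local Open Scope ring_scope.

Section OcdSets.
Variables (T : finType) (G : sgraph T).
Implicit Types (A B S : {set T}).

(** * Connected induced subgraphs *)

(** A cut criterion, so that later arguments handle edges of [G] and subsets of [T] instead of paths
    in a subtype. *)
Lemma connected_inducedP A :
  reflect (forall B, B \proper A -> B != set0 ->
             exists b a, [/\ b \in B, a \in A :\: B & adj G b a])
          (connected_graph (induced G A)).
Proof.
apply: (iffP forallP) => [conA B | cutA x].
  move=> /properP[sBA [y Ay NBy]] /set0Pn[x Bx].
  have [/existsP[b /existsP[a /and3P[]]] | ] :=
      boolP [exists b, exists a, [&& b \in B, a \in A :\: B & adj G b a]].
    by exists b, a.
  move=> /existsPn noedge.
  have noedge' b a : b \in B -> a \in A -> adj G b a -> a \in B.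
    move=> Bb Aa ba; apply: contraNT (noedge b) => NBa.
    by apply/existsP; exists a; rewrite Bb inE NBa Aa.
  (* With no edge leaving it inside [A], [B] is closed under adjacency, so no path leads from [x] to
     [y]. *)
  have clB : closed (adj (induced G A)) [pred u | val u \in B].
    move=> u v uv; rewrite !inE; apply/idP/idP => ?.
      exact: noedge' (valP v) uv.
    by apply: (noedge' (val v)); rewrite ?(valP u) // adj_sym.
  have xy := forallP (conA (Sub x (subsetP sBA x Bx))) (Sub y Ay).
  by have := closed_connect clB xy; rewrite !inE /= Bx (negPf NBy).
apply/forallP => y.
(* The component of [x], viewed in [T]: an edge leaving it would extend it, so it cannot be a proper
   subset of [A]. *)
pose B := [set val u | u in connect (adj (induced G A)) x].
have sBA : B \subset A by apply/subsetP => _ /imsetP[u _ ->]; apply: valP.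
have Bx : val x \in B by apply: imset_f; apply: connect0.
have [sAB | NsAB] := boolP (A \subset B).
  have /imsetP[u xu /val_inj->] := subsetP sAB _ (valP y).
  exact: xu.
have [||_ [a [/imsetP[u xu ->] /setDP[Aa /imsetP NBa] ua]]] := cutA B.
- by rewrite properE sBA.
- by apply/set0Pn; exists (val x).
case: NBa; exists (Sub a Aa) => //.
by apply: connect_trans xu (connect1 _).
Qed.

Lemma connected_induced0 : connected_graph (induced G set0).
Proof. by apply/forallP => -[x xP]; exfalso; rewrite inE in xP. Qed.

Lemma connected_induced1 x : connected_graph (induced G [set x]).
Proof.
apply/connected_inducedP => B; rewrite properE subset1 => /andP[/orP[]/eqP->].
  by rewrite subxx.
by rewrite eqxx.
Qed.

(** For [a] outside [B], a cut [C] of [a |: B] either is [[set a]], or contains [B] and misses [a],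
    or cuts [B] properly. The edge between [a] and [b] crosses it in the first two cases, an edge
    inside [B] in the third. *)
Lemma connected_inducedU1 B b a :
    connected_graph (induced G B) -> b \in B -> adj G b a ->
  connected_graph (induced G (a |: B)).
Proof.
move=> /connected_inducedP cutB Bb ba; apply/connected_inducedP => C.
have [Ba | NBa] := boolP (a \in B).
  by rewrite (setUidPr _) ?sub1set //; apply: cutB.
move=> /properP[sCaB [z aBz NCz]] C0.
have [CB0 | CB0] := eqVneq (C :&: B) set0.
  have sCa : C \subset [set a].
    apply/subsetP => c Cc; have := subsetP sCaB c Cc; rewrite !inE.
    case/orP=> // Bc.
    by have : c \in C :&: B by [rewrite inE Cc]; rewrite CB0 inE.
  have Ca : C = [set a] by move: sCa; rewrite subset1 (negPf C0) orbF => /eqP.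
  exists a, b; split; rewrite ?Ca ?inE ?eqxx ?Bb ?orbT ?andbT //.
    by apply: contraNneq NBa => <-.
  by rewrite adj_sym.
have [sBC | NsBC] := boolP (B \subset C).
  exists b, a; split; rewrite ?(subsetP sBC) // !inE eqxx andbT.
  apply: contraNN NCz => Ca.
  by move: aBz; rewrite !inE => /orP[/eqP-> //|/(subsetP sBC)].
have [|c [d [/setIP[Cc Bc] /setDP[Bd NCBd] cd]]] := cutB (C :&: B) _ CB0.
  by rewrite properE subsetIr subsetI subxx andbT.
exists c, d; split=> //; rewrite !inE Bd orbT andbT.
by apply: contraNN NCBd => Cd; rewrite inE Cd.
Qed.

Lemma connected_induced_subset A k :
    connected_graph (induced G A) -> (k <= #|A|)%N ->
  exists B, [/\ B \subset A, #|B| = k & connected_graph (induced G B)].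
Proof.
move=> conA; elim: k => [_ | [|k] IHk leA].
- by exists set0; rewrite sub0set cards0; split=> //; apply: connected_induced0.
(* Size one is a separate base case because the cut criterion yields an edge only for nonempty
   sets. *)
- have /card_gt0P[x Ax] := leA; exists [set x].
  by rewrite sub1set cards1; split=> //; apply: connected_induced1.
have [B [sBA cardB conB]] := IHk (ltnW leA).
have [||b [a [Bb /setDP[Aa NBa] ba]]] := connected_inducedP _ conA B.
- by rewrite properEcard sBA cardB.
- by rewrite -card_gt0 cardB.
exists (a |: B); rewrite subUset sub1set Aa sBA cardsU1 NBa cardB.
by split=> //; apply: connected_inducedU1 ba.
Qed.

(** * Outer-connected dominating sets and their sizes *)

(** When [S] is everything, its complement induces the empty graph, which is vacuously connected. *)
Lemma ocd_setE S :
  ocd_set G S = dominating G S && connected_graph (induced G (~: S)).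
Proof.
rewrite /ocd_set; case: eqVneq => // ->.
by rewrite setCT connected_induced0.
Qed.

Lemma dominatingS S S' : S \subset S' -> dominating G S -> dominating G S'.
Proof.
move=> sSS' /forallP domS; apply/forallP => v; apply/implyP => NS'v.
have /implyP/(_ (contraNN (subsetP sSS' v) NS'v)) := domS v.
case/existsP=> u /andP[Su vu].
by apply/existsP; exists u; rewrite (subsetP sSS').
Qed.

Lemma ocd_set_extend S k :
    ocd_set G S -> (#|S| <= k <= #|T|)%N ->
  exists2 S', ocd_set G S' & #|S'| = k.
Proof.
rewrite ocd_setE => /andP[domS conS] /andP[leSk lekT].
have [|B [sBS cardB conB]] := @connected_induced_subset (~: S) (#|T| - k) conS.
  by rewrite cardsCs setCK leq_sub2l.
exists (~: B); last by rewrite cardsCs setCK cardB subKn.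
by rewrite ocd_setE setCK conB andbT (dominatingS _ domS) // -setCS setCK.
Qed.

Lemma ocd_number_le S : ocd_set G S -> (ocd_number G <= #|S|)%N.
Proof.
rewrite /ocd_number; case: arg_minnP => [|S0 _ minS0]; first exact: ocd_setT.
exact: minS0.
Qed.

Lemma ocd_number_ex : exists2 S, ocd_set G S & #|S| = ocd_number G.
Proof.
rewrite /ocd_number; case: arg_minnP => [|S0 ocdS0 _]; first exact: ocd_setT.
by exists S0.
Qed.

Lemma ocd_number_leT : (ocd_number G <= #|T|)%N.
Proof. by rewrite -cardsT ocd_number_le ?ocd_setT. Qed.

Lemma ocd_number_gt0 : (0 < #|T|)%N -> (0 < ocd_number G)%N.
Proof.
case/card_gt0P=> x _; have [S /andP[domS _] <-] := ocd_number_ex.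
rewrite card_gt0; apply/eqP => S0.
have /forallP/(_ x) := domS; rewrite S0 inE /= => /existsP[u].
by rewrite inE.
Qed.

(** * Counting ocd-sets by size *)

Lemma ocd_count_gt0 i :
  (0 < ocd_count G i)%N = (ocd_number G <= i <= #|T|)%N.
Proof.
apply/card_gt0P/idP => [[S] | lei].
  by rewrite inE => /andP[ocdS /eqP<-]; rewrite ocd_number_le ?max_card.
have [S ocdS cardS] := ocd_number_ex.
have [|S' ocdS' cardS'] := @ocd_set_extend S i ocdS; first by rewrite cardS.
by exists S'; rewrite inE ocdS' cardS' /=.
Qed.

Lemma ocd_count_eq0 i :
  (ocd_count G i == 0%N) = (i < ocd_number G)%N || (#|T| < i)%N.
Proof. by rewrite -leqn0 leqNgt ocd_count_gt0 negb_and -!ltnNge. Qed.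

Lemma ocd_count_card : ocd_count G #|T| = 1%N.
Proof.
rewrite /ocd_count (_ : [set _ | _] = [set [set: T]]) ?cards1 //.
apply/setP => S; rewrite !inE; apply/andP/eqP => [[_ /eqP cardS] | ->].
  by apply/eqP; rewrite eqEcard subsetT cardsT cardS /=.
by rewrite ocd_setT cardsT.
Qed.

(** It suffices that [x] has a neighbour. With a single vertex the set would be empty and fail to
    dominate, whence the bound on [#|T|]. *)
Lemma ocd_setC1 x :
  connected_graph G -> (1 < #|T|)%N -> ocd_set G (~: [set x]).
Proof.
move=> /forallP conG T_gt1; rewrite ocd_setE setCK connected_induced1 andbT.
apply/forallP => v; rewrite !inE negbK; apply/implyP => /eqP->.
apply/existsP/existsP; apply: contraT => /existsPn Nadj.
have /card_gt1P[y [z [_ _ yz]]] := T_gt1.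
(* An isolated [x] would be its own component, making every vertex equal to [x]. *)
have clx : closed (adj G) (pred1 x).
  move=> u w uw; rewrite !inE; apply/eqP/eqP => ?; subst.
    by have := Nadj w; rewrite !inE uw andbT negbK => /eqP.
  by have := Nadj u; rewrite !inE adj_sym uw andbT negbK => /eqP.
have eqx w : w = x.
  apply/eqP; have := closed_connect clx (forallP (conG x) w).
  by rewrite !inE eqxx.
by rewrite (eqx y) (eqx z) eqxx in yz.
Qed.

(** The sets of this size are the complements of singletons, one for each vertex, and all of them
    are ocd-sets. *)
Lemma ocd_count_pred_card :
    connected_graph G -> (1 < #|T|)%N -> ocd_count G (#|T| - 1) = #|T|.
Proof.
move=> conG T_gt1; rewrite /ocd_count.
have injC1 : injective (fun x : T => ~: [set x]).
  by move=> x y /setC_inj/set1_inj.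
rewrite -[RHS]cardsT -(card_imset _ injC1); apply: eq_card => S.
rewrite inE; apply/andP/imsetP => [[_ /eqP cardS] | [x _ ->]].
  have /eqP/cards1P[x Sx] : #|~: S| = 1%N.
    by rewrite cardsCs setCK cardS subKn // ltnW.
  by exists x; rewrite // -Sx setCK.
by rewrite ocd_setC1 // cardsC1 subn1.
Qed.

(** * Coefficients, degree, monotonicity and the root at zero *)

Section Polynomial.
Variable R : realType.

Lemma coef_ocd_poly i : (ocd_poly G R)`_i = (ocd_count G i)%:R.
Proof.
have -> : ocd_poly G R = \poly_(j < #|T|.+1) (ocd_count G j)%:R.
  rewrite poly_def /ocd_poly
    -(big_mkord xpredT (fun j => (ocd_count G j)%:R *: 'X^j)).
  (* The terms below [ocd_number G] vanish, so the sum may start at 0. *)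
  rewrite [RHS](big_cat_nat (n := ocd_number G)) ?leqW ?ocd_number_leT //=.
  rewrite [X in _ = X + _]big1_seq ?add0r // => j /=.
  rewrite mem_index_iota /= => ltj.
  by have /eqP-> : ocd_count G j == 0%N; rewrite ?scale0r // ocd_count_eq0 ltj.
rewrite coef_poly ltnS; case: leqP => // ltTi.
by have /eqP-> : ocd_count G i == 0%N by rewrite ocd_count_eq0 ltTi orbT.
Qed.

(** The whole vertex set gives leading coefficient 1, so the degree is the order of the graph. *)
Lemma size_ocd_poly : size (ocd_poly G R) = #|T|.+1.
Proof.
apply/eqP; rewrite eqn_leq; apply/andP; split.
  apply/leq_sizeP => i ltTi; rewrite coef_ocd_poly.
  by have /eqP-> : ocd_count G i == 0%N by rewrite ocd_count_eq0 ltTi orbT.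
rewrite ltnNge; apply/negP => /leq_sizeP/(_ _ (leqnn _))/eqP.
by rewrite coef_ocd_poly ocd_count_card oner_eq0.
Qed.

Lemma ocd_poly_increasing (x y : R) :
  (0 < #|T|)%N -> 0 <= x -> x < y -> (ocd_poly G R).[x] < (ocd_poly G R).[y].
Proof.
move=> T_gt0 x_ge0 ltxy; rewrite !horner_coef size_ocd_poly !big_ord_recr /=.
(* The leading term, of positive degree, grows strictly; the others have nonnegative coefficients
   and grow weakly. *)
apply: ler_ltD; last first.
  by rewrite coef_ocd_poly ocd_count_card !mul1r ltrXn2r // -lt0n.
apply: ler_sum => i _; rewrite coef_ocd_poly ler_wpM2l ?ler0n //.
by apply: lerXn2r; rewrite ?nnegrE // ltW // (le_lt_trans x_ge0).
Qed.

Lemma mup_ocd_poly : mup 0 (ocd_poly G R) = ocd_number G.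
Proof.
(* Factor out the power of ['X]; the cofactor has constant term [ocd_count G (ocd_number G)], which
   is nonzero. *)
have -> : ocd_poly G R =
    drop_poly (ocd_number G) (ocd_poly G R) * ('X - 0%:P) ^+ ocd_number G.
  rewrite subr0 -[LHS](poly_take_drop (ocd_number G)).
  rewrite [X in X + _](_ : _ = 0) ?add0r //.
  apply/polyP => i; rewrite coef_take_poly coef0; case: ltnP => // lti.
  rewrite coef_ocd_poly.
  by have /eqP-> : ocd_count G i == 0%N by rewrite ocd_count_eq0 lti.
rewrite mupMr ?mup_XsubCX ?eqxx // /root horner_coef0 coef_drop_poly add0n.
by rewrite coef_ocd_poly pnatr_eq0 -lt0n ocd_count_gt0 leqnn ocd_number_leT.
Qed.

End Polynomial.
End OcdSets.

(** * Spanning subgraphs and assembly of the seven claims *)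

(** Adding edges preserves both domination and connectedness of the complement. *)
Lemma ocd_set_spanning (T : finType) (G H : sgraph T) (S : {set T}) :
  spanning_subgraph H G -> ocd_set H S -> ocd_set G S.
Proof.
move=> sHG; rewrite !ocd_setE => /andP[/forallP domS /forallP conS].
apply/andP; split; apply/forallP => v.
  apply/implyP => NSv; have /implyP/(_ NSv)/existsP[u /andP[Su vu]] := domS v.
  by apply/existsP; exists u; rewrite Su sHG.
apply/forallP => w; have := forallP (conS v) w.
by apply: connect_sub => a b ab; apply: connect1; apply: sHG.
Qed.

Theorem theorem3 (R : realType) (T : finType) (G : sgraph T) (n : nat)
    (T_gt0 : (0 < #|T|)%N) (cardT : #|T| = n) :
  [/\ (* i *)
      connected_graph G ->
        ocd_count G n = 1%N /\ ((1 < n)%N -> ocd_count G (n - 1) = n),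
      (* ii *)
      forall i : nat,
        ocd_count G i = 0%N <-> ((i < ocd_number G)%N \/ (n < i)%N),
      (* iii *)
      (ocd_poly G R)`_0 = 0,
      (* iv *)
      forall x y : R, 1 <= x -> x < y -> (ocd_poly G R).[x] < (ocd_poly G R).[y]
    & [/\ (* v *)
          forall A : {set T}, A != set0 ->
            ((size (ocd_poly (induced G A) R)).-1
               <= (size (ocd_poly G R)).-1)%N,
          (* vi *)
          mup 0 (ocd_poly G R) = ocd_number G
        & (* vii *)
          forall H : sgraph T, spanning_subgraph H G ->
            (ocd_number G <= ocd_number H)%N]].
Proof.
subst n; split.
- move=> conG; split=> [|T_gt1]; first exact: ocd_count_card.
  exact: ocd_count_pred_card.
- move=> i; split=> [/eqP|/orP]; first by rewrite ocd_count_eq0 => /orP.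
  by rewrite -ocd_count_eq0 => /eqP.
- rewrite coef_ocd_poly.
  by have /eqP-> : ocd_count G 0 == 0%N by rewrite ocd_count_eq0 ocd_number_gt0.
- by move=> x y x_ge1; apply: ocd_poly_increasing => //; apply: le_trans x_ge1.
split=> [A _||H sHG].
(* Both degrees are orders, so this compares [#|A|] with [#|T|]. *)
- by rewrite !size_ocd_poly /= card_sig max_card.
- exact: mup_ocd_poly.
have [S ocdS <-] := ocd_number_ex H.
by apply: ocd_number_le; apply: ocd_set_spanning ocdS.
Qed.
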